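(* Let $X,Y$ be Banach spaces and $T\in\mathcal L(X,Y)$. Then $$b_n(T)\le 2\sqrt2\,e_n(T),\qquad n\ge1.$$
   Context: $\mathcal L(X,Y)$ denotes the bounded linear operators from $X$ to $Y$. Bernstein numbers: $b_n(T)=\sup_{L_n}\inf_{x\in L_n,\,x\neq0}\frac{\|Tx|Y\|}{\|x|X\|}$, where the supremum is over all subspaces $L_n$ of $X$ of dimension $n$ (and $b_n(T)=0$ if there is no such subspace). (Dyadic) entropy numbers: $e_n(T)=\inf\{\varepsilon>0: T(B_X)\text{ can be covered by }2^{n-1}\text{ balls in }Y\text{ of radius }\varepsilon\}$, where $B_X=\{x\in X:\|x|X\|\le1\}$. *)

(* Defs.v *)
From HB Require Import structures.
From mathcomp Require Import all_boot all_order all_algebra.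
From mathcomp Require Import all_classical all_reals all_analysis.
From mathcomp Require Import complex.

Set Implicit Arguments.
Unset Strict Implicit.
Unset Printing Implicit Defensive.

Import Order.TTheory GRing.Theory Num.Theory.
Import numFieldNormedType.Exports.

Local Open Scope classical_set_scope.
Local Open Scope ring_scope.

Definition subspace_of_dim (K : numFieldType) (X : lmodType K) (n : nat)
    (L : set X) : Prop :=
  GRing.submod_closed [in L] /\
  exists e : 'I_n -> X,
    [/\ forall i, L (e i),
        forall a : 'I_n -> K, \sum_i a i *: e i = 0 -> forall i, a i = 0
      & forall x, L x -> exists a : 'I_n -> K, x = \sum_i a i *: e i].

(* Norms on a K-normed module take their values in K, so for complex scalars
   they are real elements of R[i]. The argument re reads such a value as an
   element of R: it is the identity for K = R and the real part for K = R[i].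
   Extended reals keep all suprema and infima meaningful. *)
Section NumbersOfAnOperator.
Variables (R : realType) (K : numFieldType) (re : K -> R).
Variables (X Y : normedModType K) (T : X -> Y).

Definition bernstein_number (n : nat) : \bar R :=
  if `[< exists L : set X, subspace_of_dim n L >] then
    ereal_sup [set ereal_inf [set (re (`|T x| / `|x|))%:E
                             | x in [set x | L x /\ x <> 0]]
              | L in [set L : set X | subspace_of_dim n L]]
  else 0%E.

(* Repetitions among the 2 ^ (n - 1) centres are allowed. For n = 0, which is
   outside the scope of the notion, n.-1 is 0. *)
Definition entropy_number (n : nat) : \bar R :=
  ereal_inf [set (re eps)%:E
            | eps in [set eps : K | 0 < eps /\
                exists c : 'I_(2 ^ n.-1) -> Y,
                  T @` closed_ball_ Num.norm 0 1 `<=`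
                  \bigcup_i closed_ball_ Num.norm (c i) eps]].

End NumbersOfAnOperator.

(* Main.v *)
Require Import Defs.
From HB Require Import structures.
From mathcomp Require Import all_boot all_order all_algebra.
From mathcomp Require Import all_classical all_reals all_analysis.
From mathcomp Require Import complex zify ring lra.

Import Order.TTheory GRing.Theory Num.Theory.
Import numFieldNormedType.Exports.

Local Open Scope ring_scope.

(** The proof gives the bound 2 in place of 2 sqrt 2. Let [L] have dimension
    [n] with [b |x| <= |T x|] on it, and let balls of radius [eps], [2 ^ (n-1)]
    in number, cover the image of the unit ball. Seen as a real space, [L] has
    dimension [m >= n], and [N a = |T v(a)|], where [v] is a real coordinate
    map, is a norm on R^m. The ball [N <= b] is covered by fewer than [2 ^ m]
    sets of [N]-diameter at most [d = 2 eps]. An isodiametric inequality, the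
    consequence [vol (A - A) >= 2 ^ m vol A] of Brunn-Minkowski, would now
    yield [2 ^ m vol (N <= b) < 2 ^ m vol (N <= d)], hence [b <= d]. Comparing
    the balls by the triangle inequality alone would lose a factor 2, giving
    about [4 eps] for real scalars, which is too weak.

    Volumes are replaced by counting lattice points. The discrete form of
    Brunn-Minkowski states that [|A + B + {0,1}^m| >= 2 ^ m sqrt (|A| |B|)] for
    finite subsets of Z^m; it follows by induction on [m] from the functional
    inequality [discrete_prekopa_leindler1] on Z, itself a layer-cake
    consequence of [|A + B| >= |A| + |B| - 1]. Suppose [d < b] and scale the
    lattice so finely, by a factor [K], that the error caused by the cube
    {0,1}^m is at most [K (b - d)]. The set [G] of lattice points with
    [N <= K b] is cut into fewer than [2 ^ m] pieces [A], and every
    [A - A + {0,1}^m] still lies in [G], so [2 ^ m |A| <= |G|]. Summing over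
    the pieces gives [2 ^ m |G| < 2 ^ m |G|] ([cover_radius_le]). No asymptotic
    count is needed, since [G] is compared only with itself; that [G] is finite
    is the equivalence of norms on R^m. *)

(** * A Prekopa-Leindler inequality on lattice boxes *)

(** The sumset bound [|A + B| >= |A| + |B| - 1] on the line, where the extra
    shift by [0] or [1] absorbs the [-1]: the translates [A + min B] and
    [max A + B + 1] lie in [C] and are disjoint because the first ends at
    [max A + min B] and the second begins just after. *)
Lemma card_sumset_ge (M : nat) (A B : {set 'I_M}) (C : {set 'I_M.*2}) :
  A != finset.set0 -> B != finset.set0 ->
  (forall (x y : 'I_M) (z : 'I_M.*2), x \in A -> y \in B ->
     (x + y <= z <= (x + y).+1)%N -> z \in C) ->
  (#|A| + #|B| <= #|C|)%N.
Proof.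
move=> /set0Pn[x0 x0A] /set0Pn[y0 y0B] ABC.
have [a aA amax] := @arg_maxnP _ x0 (mem A) (fun x : 'I_M => x : nat) x0A.
have [b bB bmin] := @arg_minnP _ y0 (mem B) (fun x : 'I_M => x : nat) y0B.
have lt1 (x y : 'I_M) : ((x + y).+1 < M.*2)%N by move: (ltn_ord x) (ltn_ord y); lia.
pose low (x : 'I_M) : 'I_M.*2 := Ordinal (ltnW (lt1 x b)).
pose high (y : 'I_M) : 'I_M.*2 := Ordinal (lt1 a y).
have injlow : injective low.
  by move=> x y /(congr1 val) /= h; apply: ord_inj; lia.
have injhigh : injective high.
  by move=> x y /(congr1 val) /= h; apply: ord_inj; lia.
rewrite -(card_imset _ injlow) -(card_imset _ injhigh) -cardsUI.
rewrite [X in (_ + X)%N](_ : _ = 0%N) ?addn0.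
  apply: subset_leq_card; apply/fintype.subsetP => z.
  case/finset.setUP => /imsetP[w wA ->].
    by apply: (ABC w b) => //=; lia.
  by apply: (ABC a w) => //=; lia.
apply/eqP; rewrite cards_eq0; apply/eqP/finset.setP => z; rewrite !inE.
apply/negbTE/negP => /andP[/imsetP[x xA ->] /imsetP[y yB]] /(congr1 val) /=.
by move: (amax x xA) (bmin y yB) => /=; lia.
Qed.

Lemma layer_cake (I : finType) (L : nat) (f : I -> nat) :
  (forall i, f i <= L)%N ->
  (\sum_i f i = \sum_(l < L) #|[set i | (l < f i)%N]|)%N.
Proof.
move=> fL.
under [RHS]eq_bigr do rewrite -sum1dep_card big_mkcond.
rewrite exchange_big /=; apply: eq_bigr => i _.
by rewrite -big_mkcond -(big_ord_widen L (fun=> 1%N)) ?sum1_card ?card_ord.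
Qed.

(** Applying the sumset bound to the superlevel sets of [f], [g] and [h], level
    by level. The maxima of [f] and [g] have to agree for the superlevel sets of
    both to be nonempty at the same levels. *)
Lemma sum_add_min (M L : nat) (f g : 'I_M -> nat) (h : 'I_M.*2 -> nat)
    (xf xg : 'I_M) :
  f xf = L -> g xg = L ->
  (forall x, f x <= L)%N -> (forall y, g y <= L)%N -> (forall z, h z <= L)%N ->
  (forall (x y : 'I_M) (z : 'I_M.*2),
     (x + y <= z <= (x + y).+1 -> minn (f x) (g y) <= h z)%N) ->
  (\sum_x f x + \sum_y g y <= \sum_z h z)%N.
Proof.
move=> fxf gxg fL gL hL fgh.
rewrite (layer_cake _ L f)// (layer_cake _ L g)// (layer_cake _ L h)//.
rewrite -big_split; apply: leq_sum => l _ /=; apply: card_sumset_ge.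
- by apply/set0Pn; exists xf; rewrite inE fxf.
- by apply/set0Pn; exists xg; rewrite inE gxg.
- by move=> x y z; rewrite !inE => fx gy /fgh; apply: leq_trans; rewrite leq_min fx gy.
Qed.

(** Multiplying [f] by [max g] and [g] by [max f] equalizes their maxima, and
    [h] is scaled by the geometric mean [w] of the two; then [sum_add_min]
    followed by the inequality of arithmetic and geometric means gives the
    claim. Squares stand in for the geometric means in the classical
    formulation. *)
Lemma discrete_prekopa_leindler1 (R : realType) (M : nat) (f g : 'I_M -> nat)
    (h : 'I_M.*2 -> R) :
  (forall z, 0 <= h z) ->
  (forall (x y : 'I_M) (z : 'I_M.*2),
     (x + y <= z <= (x + y).+1)%N -> (f x * g y)%:R <= h z ^+ 2) ->
  4 * (\sum_x f x)%:R * (\sum_y g y)%:R <= (\sum_z h z) ^+ 2.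
Proof.
move=> h0 fgh.
have [/existsP[x1 fx1]|/existsPn f0] := boolP [exists x, f x != 0]%N; last first.
  by rewrite [in X in 4 * X]big1 ?mulr0 ?mul0r ?sqr_ge0// => x _; have /negPn/eqP := f0 x.
have [/existsP[y1 gy1]|/existsPn g0] := boolP [exists x, g x != 0]%N; last first.
  by rewrite [X in _ * X%:R]big1 ?mulr0 ?sqr_ge0// => x _; have /negPn/eqP := g0 x.
have [a _ amax'] := @arg_maxnP _ x1 predT f erefl.
have amax x : (f x <= f a)%N by exact: amax'.
have [b _ bmax'] := @arg_maxnP _ y1 predT g erefl.
have bmax y : (g y <= g b)%N by exact: bmax'.
have fa : (0 < f a)%N by rewrite (leq_trans _ (amax x1))// lt0n.
have gb : (0 < g b)%N by rewrite (leq_trans _ (bmax y1))// lt0n.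
pose w : R := Num.sqrt (f a * g b)%:R.
have w2 : w ^+ 2 = (f a * g b)%:R by rewrite sqr_sqrtr.
have w0 : 0 <= w by exact: sqrtr_ge0.
(* The truncation keeps natural-number levels, and no level above max f * max g
   is needed. *)
pose hn z := minn (f a * g b) (Num.truncn (w * h z)).
have := @sum_add_min M (f a * g b) (fun x => f x * g b)%N (fun y => f a * g y)%N
  hn a b erefl erefl.
move=> /(_ _ _ _ _)/wrap[].
- by move=> x; rewrite leq_mul2r amax ?orbT.
- by move=> x; rewrite leq_mul2l bmax ?orbT.
- by move=> z; rewrite geq_minl.
- move=> x y z xyz; rewrite leq_min; apply/andP; split.
    by rewrite geq_min leq_mul2r amax ?orbT.
  rewrite truncn_ge_nat ?mulr_ge0//.
  rewrite -ler_sqr ?nnegrE ?mulr_ge0// exprMn w2.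
  apply: le_trans (ler_wpM2l _ (fgh x y z xyz)) => //.
  rewrite -natrX -natrM ler_nat; set p := minn _ _; rewrite expnS expn1.
  rewrite (_ : (f a * g b * _)%N = (f x * g b) * (f a * g y))%N; last by lia.
  by rewrite leq_mul ?geq_minl ?geq_minr.
rewrite -!big_distrr -!big_distrl /= => sum_le.
have sum_hn : (\sum_z hn z)%:R <= w * \sum_z h z.
  rewrite mulr_sumr natr_sum; apply: ler_sum => z _.
  apply: (@le_trans _ _ (Num.truncn (w * h z))%:R); first by rewrite ler_nat geq_minr.
  by rewrite truncn_le mulr_ge0.
set F := (\sum_i f i)%N in sum_le *; set G := (\sum_i g i)%N in sum_le *.
have le2 : (F * g b + f a * G)%:R ^+ 2 <= w ^+ 2 * (\sum_z h z) ^+ 2.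
  rewrite -exprMn ler_sqr ?nnegrE ?mulr_ge0 ?sumr_ge0//.
  by apply: le_trans sum_hn; rewrite ler_nat.
rewrite w2 natrD !natrM in le2.
have fa' : 0 < (f a)%:R :> R by rewrite ltr0n.
have gb' : 0 < (g b)%:R :> R by rewrite ltr0n.
rewrite -(ler_pM2l (mulr_gt0 fa' gb')); apply: le_trans le2.
rewrite -subr_ge0 (_ : _ - _ = (F%:R * (g b)%:R - (f a)%:R * G%:R) ^+ 2) ?sqr_ge0//.
by ring.
Qed.

Definition fcons {T : Type} {m : nat} (t : T) (v : {ffun 'I_m -> T}) :
    {ffun 'I_m.+1 -> T} :=
  [ffun i => if unlift ord0 i is Some j then v j else t].

Lemma big_fcons (S : Type) (idx : S) (op : Monoid.com_law idx) (T : finType)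
    (m : nat) (F : {ffun 'I_m.+1 -> T} -> S) :
  \big[op/idx]_u F u =
  \big[op/idx]_(t : T) \big[op/idx]_(v : {ffun 'I_m -> T}) F (fcons t v).
Proof.
rewrite pair_big /= (reindex (fun p => fcons p.1 p.2)) //=.
exists (fun u => (u ord0, [ffun j => u (lift ord0 j)])) => [[t v] _|u _] /=.
  rewrite /fcons ffunE unlift_none; congr pair.
  by apply/ffunP => j; rewrite !ffunE liftK.
apply/ffunP => i; rewrite ffunE; case: unliftP => [j ->|->//].
by rewrite ffunE.
Qed.

(** Tensorization: summing over all coordinates but the first, the induction
    hypothesis compares the fibre sums of [f], [g] and [h], which therefore
    satisfy, up to the factor [2 ^ m], the hypothesis of the one-dimensional
    inequality. On indicator functions of sets [A] and [B] this is
    [|A + B + {0,1}^m| >= 2 ^ m sqrt (|A| |B|)]. *)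
Lemma discrete_prekopa_leindler (R : realType) (m M : nat)
    (f g : {ffun 'I_m -> 'I_M} -> nat) (h : {ffun 'I_m -> 'I_M.*2} -> R) :
  (forall z, 0 <= h z) ->
  (forall (x y : {ffun 'I_m -> 'I_M}) (z : {ffun 'I_m -> 'I_M.*2}),
     (forall i, x i + y i <= z i <= (x i + y i).+1)%N ->
     (f x * g y)%:R <= h z ^+ 2) ->
  4 ^+ m * (\sum_x f x)%:R * (\sum_y g y)%:R <= (\sum_z h z) ^+ 2.
Proof.
elim: m => [|m IHm] in f g h *.
  move=> h0 fgh.
  have one (T : Type) (x y : {ffun 'I_0 -> T}) : x = y by apply/ffunP => -[].
  pose o T : {ffun 'I_0 -> T} := [ffun i : 'I_0 => False_rect T (notF (ltn_ord i))].
  rewrite expr0 mul1r (big_pred1 (o _)) ?(big_pred1 (o _)) ?(big_pred1 (o 'I_(M.*2))).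
  - by rewrite -natrM; apply: fgh => -[].
  - by move=> x; apply/esym/eqP/one.
  - by move=> x; apply/esym/eqP/one.
  - by move=> x; apply/esym/eqP/one.
move=> h0 fgh; rewrite !big_fcons /=.
pose H z := \sum_(w : {ffun 'I_m -> 'I_M.*2}) h (fcons z w).
have p2 : 0 < 2 ^+ m :> R by rewrite exprn_gt0.
have p4 : 4 ^+ m = (2 ^+ m) ^+ 2 :> R by rewrite exprAC -(natrX _ 2 2).
have := @discrete_prekopa_leindler1 R M
  (fun t => \sum_v f (fcons t v))%N (fun t => \sum_v g (fcons t v))%N
  (fun z => H z / 2 ^+ m).
move=> /(_ _ _)/wrap[].
- by move=> z; rewrite divr_ge0 ?sumr_ge0// ltW.
- move=> x y z xyz.
  rewrite expr_div_n -p4 ler_pdivlMr ?exprn_gt0// natrM mulrC mulrA.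
  apply: IHm => // u v w uvw; apply: fgh => i; rewrite !ffunE.
  by case: unliftP.
rewrite -mulr_suml expr_div_n -p4 ler_pdivlMr ?exprn_gt0//.
by apply: le_trans; rewrite le_eqVlt exprS; apply/orP; left; apply/eqP; ring.
Qed.

(** * Norms on R^m *)

Definition is_norm (R : realType) (V : lmodType R) (N : V -> R) : Prop :=
  [/\ forall x y, N (x + y) <= N x + N y,
      forall k x, N (k *: x) = `|k| * N x
    & forall x, N x = 0 -> x = 0].
Arguments is_norm {R V} N.

Section Norm.
Variables (R : realType) (V : lmodType R) (N : V -> R).
Hypothesis normN : is_norm N.

Lemma is_norm0 : N 0 = 0.
Proof. by case: normN => _ NZ _; rewrite -(scale0r 0) NZ normr0 mul0r. Qed.

Lemma is_normN x : N (- x) = N x.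
Proof. by case: normN => _ NZ _; rewrite -scaleN1r NZ normrN1 mul1r. Qed.

Lemma is_norm_ge0 x : 0 <= N x.
Proof.
case: normN => ND _ _; have := ND x (- x).
by rewrite subrr is_norm0 is_normN -mulr2n pmulrn_lge0.
Qed.

End Norm.

Section RowNorm.
Variables (R : realType) (m : nat) (N : 'rV[R]_m -> R).
Hypothesis normN : is_norm N.

Let D := \sum_j N (delta_mx 0 j).

Lemma is_norm_le_entries (t : R) (x : 'rV[R]_m) :
  (forall j, `|x 0 j| <= t) -> N x <= t * D.
Proof.
move=> xt; have [ND NZ _] := normN.
have Nsum (u : 'I_m -> 'rV[R]_m) : N (\sum_j u j) <= \sum_j N (u j).
  elim/big_rec2 : _ => [|j y z _ yz]; first by rewrite (is_norm0 _ _ _ normN).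
  by rewrite (le_trans (ND _ _))// lerD2l.
rewrite {1}[x]row_sum_delta (le_trans (Nsum _))// mulr_sumr ler_sum// => j _.
by rewrite NZ ler_wpM2r// (is_norm_ge0 _ _ _ normN).
Qed.

Lemma entry_le_norm (x : 'rV[R]_m) j : `|x 0 j| <= `|x|.
Proof.
rewrite [leRHS]/Num.norm /= mx_normrE; apply/bigmax_geP; right => /=.
by exists (0, j).
Qed.

Lemma is_norm_continuous : continuous N.
Proof.
have [ND NZ _] := normN => x; apply/(@cvgrPdist_lt R R _ (nbhs x)) => e e0.
have D0 : 0 <= D by apply: sumr_ge0 => j _; exact: is_norm_ge0.
near=> y.
have dN u v : N u - N v <= N (u - v) by rewrite lerBlDr -{1}(subrK v u) ND.
apply: (@le_lt_trans _ _ (N (x - y))).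
  rewrite ler_norml dN andbT lerNl opprB (le_trans (dN _ _))//.
  by rewrite -(is_normN _ _ _ normN) opprB.
apply: le_lt_trans (is_norm_le_entries _ _ (entry_le_norm _)) _.
apply: (@le_lt_trans _ _ (`|x - y| * (D + 1))); first by rewrite ler_wpM2l// lerDl.
rewrite -ltr_pdivlMr ?ltr_wpDl//.
near: y; apply: cvgr_dist_lt => //.
by rewrite divr_gt0// ltr_wpDl.
Unshelve. all: by end_near. Qed.

(** By compactness [N] attains its minimum on the unit sphere of the supremum
    norm, and that minimum is positive. The sphere is empty when [m = 0]. *)
Lemma is_norm_equiv : exists2 c, 0 < c & forall x : 'rV[R]_m, c * `|x| <= N x.
Proof.
have [ND NZ Ndef] := normN.
pose S := [set x : 'rV[R]_m | `|x| = 1]%classic.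
have S1 (x : 'rV[R]_m) : x != 0 -> S (`|x|^-1 *: x).
  by move=> x0; rewrite /S /= normrZ normfV normr_id mulVf ?normr_eq0.
have [[s Ss]|S0] := pselect (S !=set0)%classic; last first.
  exists 1 => // x; have [->|/S1 Sx] := eqVneq x 0.
    by rewrite normr0 mulr0 is_norm_ge0.
  by exfalso; apply: S0; exists (`|x|^-1 *: x).
have Scompact : compact S.
  apply: bounded_closed_compact.
    by exists 1; split => // t t1 x /= ->; exact: ltW.
  have := @preimage_closed 'rV[R]_m R (fun x => `|x|) [set x | x = 1]%classic.
  by apply; [move=> x _; exact: norm_continuous | exact: closed_eq].
have [c cS cmin] := @EVT_min_rV R m N S (ex_intro _ s Ss) Scompact
  (continuous_subspaceT is_norm_continuous).
rewrite inE in cS.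
exists (N c).
  rewrite lt_neqAle is_norm_ge0// andbT eq_sym; apply/eqP => /Ndef c0.
  by move: cS; rewrite /S /= c0 normr0 => /esym/eqP; rewrite oner_eq0.
move=> x; have [->|x0] := eqVneq x 0; first by rewrite normr0 mulr0 is_norm_ge0.
have := cmin (`|x|^-1 *: x); rewrite inE => /(_ (S1 x x0)).
by rewrite NZ normfV normr_id mulrC ler_pdivlMr ?normr_gt0.
Qed.

End RowNorm.

(** * Coverings of a ball by sets of bounded diameter *)

Section Covering.
Variables (R : realType) (m k : nat) (N : 'rV[R]_m -> R).
Variables (b d : R) (S : 'I_k -> 'rV[R]_m -> Prop).
Hypothesis normN : is_norm N.
Hypothesis km : (k < 2 ^ m)%N.
Hypothesis d0 : 0 <= d.
Hypothesis coverS : forall a, N a <= b -> exists i, S i a.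
Hypothesis diamS : forall i a a', S i a -> S i a' -> N (a - a') <= d.

(** If [d < b], count lattice points in the balls dilated by a large [K]: the
    set [G] of those with [N <= K b] is cut by the covering into pieces [A i].
    Differences of points of [A i], moved by an element of the cube {0,1}^m,
    satisfy [N <= K d + D <= K b] and so lie in [G] again; hence
    [2 ^ m #|A i| <= #|G|], which contradicts [k < 2 ^ m] after summation. *)
Lemma cover_radius_le : b <= d.
Proof.
have [ND NZ _] := normN.
have [c c0 cN] := is_norm_equiv _ _ _ normN.
rewrite leNgt; apply/negP => db.
have db0 : 0 < b - d by rewrite subr_gt0.
(* D bounds N on the cube, and K makes K (b - d) at least D. *)
pose D := \sum_j N (delta_mx 0 j).
pose K : R := (Num.truncn (D / (b - d))).+1%:R.
have K0 : 0 < K by rewrite ltr0n.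
have Kdb : K * d + D <= K * b.
  rewrite -lerBrDl -mulrBr -ler_pdivrMr//; apply: ltW.
  by rewrite /K real_truncnS_gt ?num_real.
(* The lattice points of G lie in the box [-B, B]^m. They are encoded by
   x |-> x + B in [0, 2B]^m, so that sums of two of them, plus 0 or 1, are
   encoded by z |-> z + 2B in [0, 4B + 1]^m. *)
pose B := (Num.truncn (K * b / c)).+1.
have B2 : B.*2%:R = B%:R + B%:R :> R by rewrite -addnn natrD.
have BK : K * b <= c * B%:R.
  by rewrite [leRHS]mulrC -ler_pdivrMr// ltW// /B real_truncnS_gt ?num_real.
pose M := B.*2.+1.
pose p (x : {ffun 'I_m -> 'I_M}) : 'rV[R]_m := \row_i ((x i)%:R - B%:R).
pose q (z : {ffun 'I_m -> 'I_M.*2}) : 'rV[R]_m := \row_i ((z i)%:R - B.*2%:R).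
pose opp (y : {ffun 'I_m -> 'I_M}) := [ffun i => rev_ord (y i)].
have oppK : involutive opp by move=> y; apply/ffunP => i; rewrite !ffunE rev_ordK.
have p_opp y : p (opp y) = - p y.
  apply/rowP => i; rewrite !mxE ffunE /= subSS natrB; last by move: (ltn_ord (y i)); lia.
  by rewrite B2; ring.
pose G := [set x | N (p x) <= K * b].
pose A i := [set x in G | `[< S i (K^-1 *: p x) >]].
pose C := [set z | N (q z) <= K * d + D].
have G_le_A : (#|G| <= \sum_i #|A i|)%N.
  under eq_bigr do rewrite -sum1_card big_mkcond.
  rewrite exchange_big -sum1_card big_mkcond /=; apply: leq_sum => x _.
  case: ifP => // xG.
  have [i Si] : exists i, S i (K^-1 *: p x).
    apply: coverS; rewrite NZ normfV gtr0_norm// ler_pdivrMl//.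
    by move: xG; rewrite finset.in_set.
  rewrite (bigD1 i) //= ifT ?leq_addr//.
  by rewrite finset.in_set xG; apply/asboolP.
have A_le_C i : (2 ^ m * #|A i| <= #|C|)%N.
  (* Brunn-Minkowski for A i and its reflection, written with indicators. *)
  pose f x : nat := x \in A i.
  have sumf : (\sum_x f x = #|A i|)%N.
    by rewrite -sum1_card [RHS]big_mkcond; apply: eq_bigr => x _; rewrite /f; case: ifP.
  have := @discrete_prekopa_leindler R m M f (f \o opp) (fun z => (z \in C)%:R).
  move=> /(_ _ _)/wrap[].
  - by move=> z; rewrite ler0n.
  - move=> x y z xyz; rewrite /f /=.
    have [/andP[xA yA]|] := boolP ((x \in A i) && (opp y \in A i)); last first.
      by rewrite negb_and => /orP[] /negbTE ->; rewrite ?muln0 sqr_ge0.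
    rewrite xA yA (_ : z \in C) ?expr1n// finset.in_set.
    rewrite -(subrK (p x - p (opp y)) (q z)) addrC (le_trans (ND _ _))// lerD//.
      move: xA yA; rewrite !finset.in_set => /andP[_ /asboolP Sx] /andP[_ /asboolP Sy].
      have := diamS _ _ _ Sx Sy; rewrite -scalerBr NZ normfV gtr0_norm//.
      by rewrite ler_pdivrMl.
    rewrite -[D]mul1r is_norm_le_entries// => j; rewrite p_opp !mxE.
    have /andP[] := xyz j; rewrite -(ler_nat R) -(ler_nat R (z j)) -natr1 natrD => zlo zhi.
    by rewrite ler_norml B2; apply/andP; split; lra.
  have -> : (\sum_y (f \o opp) y = #|A i|)%N.
    by rewrite -sumf [RHS](reindex_inj (inv_inj oppK)).
  have -> : \sum_z (z \in C)%:R = #|C|%:R :> R.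
    by rewrite -natr_sum -sum1_card [in RHS]big_mkcond; congr _%:R; apply: eq_bigr => z _; case: ifP.
  have -> : 4 ^+ m = (2 ^ m)%:R ^+ 2 :> R by rewrite natrX exprAC -(natrX _ 2 2).
  by rewrite sumf -mulrA -expr2 -exprMn ler_sqr ?nnegrE// -natrM ler_nat.
have C_le_G : (#|C| <= #|G|)%N.
  pose shift (z : {ffun 'I_m -> 'I_M.*2}) : {ffun 'I_m -> 'I_M} :=
    [ffun i => inord (z i - B)].
  have zB z i : z \in C -> (B <= z i <= B + B.*2)%N.
    rewrite finset.in_set => zC.
    have : `|(z i)%:R - B.*2%:R| <= B%:R :> R.
      rewrite -(ler_pM2l c0); apply: le_trans BK; apply: le_trans Kdb.
      apply: le_trans zC; apply: le_trans (cN _); rewrite ler_pM2l//.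
      by have := entry_le_norm _ _ (q z) i; rewrite mxE.
    rewrite ler_norml B2 => /andP[zlo zhi].
    by apply/andP; split; rewrite -(ler_nat R) ?natrD ?B2; lra.
  have shiftE z i : z \in C -> shift z i = (z i - B)%N :> nat.
    by move=> /zB => /(_ i) /andP[_ zi]; rewrite ffunE inordK// ltnS leq_subLR.
  have shift_inj : {in C &, injective shift}.
    move=> z z' zC z'C zz'; apply/ffunP => i; apply: ord_inj.
    have := congr1 (fun u : {ffun 'I_m -> 'I_M} => u i : nat) zz'.
    have /andP[lo _] := zB z i zC; have /andP[lo' _] := zB z' i z'C.
    by rewrite !shiftE// => e; rewrite -(subnK lo) e subnK.
  rewrite -(card_in_imset shift_inj) subset_leq_card//.
  apply/fintype.subsetP => _ /imsetP[z zC ->]; rewrite finset.in_set.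
  rewrite (_ : p _ = q z).
    by apply: le_trans Kdb; move: zC; rewrite finset.in_set.
  apply/rowP => i; rewrite !mxE shiftE// natrB; last by case/andP: (zB z i zC).
  by rewrite B2; ring.
have G0 : (0 < #|G|)%N.
  have BM : (B < M)%N by rewrite ltnS -addnn leq_addl.
  apply/card_gt0P; exists [ffun => Ordinal BM]; rewrite finset.in_set.
  have -> : p [ffun => Ordinal BM] = 0 by apply/rowP => i; rewrite !mxE ffunE subrr.
  by rewrite (is_norm0 _ _ _ normN) mulr_ge0// ltW// (le_lt_trans d0).
have : (2 ^ m * #|G| <= k * #|G|)%N.
  apply: leq_trans (leq_mul (leqnn _) G_le_A) _.
  rewrite big_distrr /=.
  have := @leq_sum _ (index_enum 'I_k) xpredT _ _ (fun i _ => A_le_C i).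
  move=> /leq_trans; apply.
  by rewrite sum_nat_const card_ord leq_mul.
by rewrite leq_pmul2r// leqNgt km.
Qed.
End Covering.

Local Open Scope classical_set_scope.

(** * From coverings to Bernstein and entropy numbers *)

(** The real and the complex case share one argument: [coe] embeds the real
    numbers into the scalars, and [re] inverts it on values of norms. *)
Section RealScalars.
Variables (R : realType) (K : numFieldType) (re : K -> R).
Variable coe : {rmorphism R -> K}.
Hypothesis coe_mono : {mono coe : x y / x <= y}.
Hypothesis coe_reK : forall z : K, 0 <= z -> coe (re z) = z.

Definition real_free {X : lmodType K} {m : nat} (f : 'I_m -> X) : Prop :=
  forall a : 'I_m -> R, \sum_i coe (a i) *: f i = 0 -> forall i, a i = 0.

Variables (X Y : normedModType K) (T : {linear X -> Y}).

Lemma norm_coe r : `|coe r| = coe `|r|.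
Proof.
have [r0|r0] := leP 0 r.
  by rewrite !ger0_norm// -(rmorph0 coe) coe_mono.
rewrite !ltr0_norm ?rmorphN//.
by rewrite -(rmorph0 coe) (leW_mono coe_mono).
Qed.

Lemma re_ge0 z : 0 <= z -> 0 <= re z.
Proof. by move=> z0; rewrite -coe_mono rmorph0 coe_reK. Qed.

(** Pulling the covering of [T (B_X)] back along real coordinates on the span of
    [f]: since [b |x| <= |T x|] there, points with [|T x| <= b] lie in the unit
    ball, and two points whose images share a ball of radius [eps] have images
    at distance at most [2 eps]. *)
Lemma bound_le_cover_radius (L : set X) (m k : nat) (f : 'I_m -> X)
    (b : R) (eps : K) (c : 'I_k -> Y) :
  GRing.submod_closed [in L] -> (forall i, L (f i)) -> real_free f ->
  0 < b -> (forall x, L x -> x <> 0 -> b <= re (`|T x| / `|x|)) ->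
  (k < 2 ^ m)%N -> 0 <= eps ->
  T @` closed_ball_ Num.norm 0 1 `<=` \bigcup_i closed_ball_ Num.norm (c i) eps ->
  b <= 2 * re eps.
Proof.
move=> [L0 LD] Lf ffree b0 bT km eps0 cover.
pose v (a : 'rV[R]_m) := \sum_i coe (a 0 i) *: f i.
have vD a a' : v (a + a') = v a + v a'.
  by rewrite -big_split; apply: eq_bigr => i _; rewrite mxE rmorphD scalerDl.
have vZ r a : v (r *: a) = coe r *: v a.
  by rewrite scaler_sumr; apply: eq_bigr => i _; rewrite mxE rmorphM scalerA.
have Lv a : L (v a).
  have Lin x : x \in L -> L x by rewrite inE.
  apply: Lin; rewrite /v; elim/big_ind : _ => // [x y xL yL|i _].
    by have := LD 1 _ _ xL yL; rewrite scale1r.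
  rewrite -[_ *: _]addr0; apply: LD => //.
  by rewrite inE; exact: Lf.
have Tv a : coe b * `|v a| <= `|T (v a)|.
  have [->|va0] := eqVneq (v a) 0; first by rewrite linear0 !normr0 mulr0.
  rewrite -ler_pdivlMr ?normr_gt0// -[leRHS]coe_reK ?divr_ge0// coe_mono.
  by apply: bT => //; exact/eqP.
pose N a := re `|T (v a)|.
have coeN a : coe (N a) = `|T (v a)| by rewrite coe_reK.
have normN : is_norm N.
  split=> [a a'|r a|a Na0].
  - by rewrite -coe_mono rmorphD !coeN vD linearD ler_normD.
  - by apply: (fmorph_inj coe); rewrite rmorphM !coeN vZ linearZ normrZ norm_coe.
  - have va0 : v a = 0.
      apply/eqP; rewrite -normr_le0; have := Tv a.
      rewrite -coeN Na0 rmorph0 pmulr_rle0//.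
      by rewrite -(rmorph0 coe) (leW_mono coe_mono).
    by apply/rowP => i; rewrite mxE (ffree _ va0).
apply: (@cover_radius_le R m k N b _ (fun i a => `|c i - T (v a)| <= eps)) => //.
- by rewrite mulr_ge0// re_ge0.
- move=> a Nab.
  have va1 : `|v a| <= 1.
    rewrite -(@ler_pM2l _ (coe b)); last first.
      by rewrite -(rmorph0 coe) (leW_mono coe_mono).
    by rewrite mulr1 (le_trans (Tv a))// -coeN coe_mono.
  have [|i _ ci] := cover (T (v a)); last by exists i.
  by exists (v a) => //; rewrite /closed_ball_ /= sub0r normrN.
- move=> i a a' ai a'i.
  rewrite -coe_mono coeN rmorphM rmorph_nat coe_reK// mulr_natl mulr2n.
  rewrite -scaleN1r vD vZ rmorphN1 scaleN1r linearB.
  rewrite -(subrKA (c i)) (le_trans (ler_normD _ _))// lerD//.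
  by rewrite distrC.
Qed.

(** A real-free family of at least [n] vectors is enough, so that both a basis
    over the reals and the [2 n] vectors of a realified complex basis serve. *)
Lemma bernstein_le_entropy (n : nat) :
  (0 < n)%N ->
  (forall L : set X, subspace_of_dim n L ->
     exists (m : nat) (f : 'I_m -> X),
       [/\ (n <= m)%N, forall i, L (f i) & real_free f]) ->
  (bernstein_number re T n <= (2 * Num.sqrt 2)%:E * entropy_number re T n)%E.
Proof.
move=> n0 basis.
have C0 : 0 < 2 * Num.sqrt 2 :> R by rewrite mulr_gt0// sqrtr_gt0.
have C2 : 2 <= 2 * Num.sqrt 2 :> R.
  by rewrite ler_peMr// -[leLHS]sqrtr1 ler_wsqrtr// ler1n.
rewrite muleC -lee_pdivrMr//; apply: le_ereal_inf_tmp => _ [eps [eps0 [c cover]] <-].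
rewrite lee_pdivrMr// -EFinM.
have reeps : 0 <= re eps by rewrite re_ge0// ltW.
rewrite /bernstein_number; case: ifPn => _; last by rewrite lee_fin mulr_ge0// ltW.
apply: ge_ereal_sup => _ [L Ldim <-].
apply: (@le_trans _ _ (2 * re eps)%:E); last first.
  by rewrite lee_fin mulrC ler_wpM2l.
have [m [f [nm Lf ffree]]] := basis L Ldim.
have bound b : (forall x, L x -> x <> 0 -> b <= re (`|T x| / `|x|)) -> b <= 2 * re eps.
  move=> bT; have [b0|b0] := ltP 0 b; last by rewrite (le_trans b0)// mulr_ge0.
  apply: (bound_le_cover_radius _ _ _ _ _ _ _ _ Lf ffree b0 bT _ _ cover) => //.
  - by case: Ldim.
  - by rewrite ltn_exp2l//; lia.
  - exact: ltW.
set I := ereal_inf _.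
have lbI x : L x -> x <> 0 -> (I <= (re (`|T x| / `|x|))%:E)%E.
  by move=> Lx x0; apply: ereal_inf_lbound; exists x.
case: I lbI => [r||] lbI; last by rewrite leNye.
  by rewrite lee_fin; apply: bound => x Lx x0; rewrite -lee_fin lbI.
(* An infinite infimum would make every real number a lower bound. *)
have : 2 * re eps + 1 <= 2 * re eps.
  by apply: bound => x Lx x0; have := lbI x Lx x0; rewrite leye_eq.
by rewrite gerDl ler10.
Qed.

End RealScalars.

Theorem lemma3p3 (R : realType) :
  (* real Banach spaces *)
  (forall (X Y : completeNormedModType R) (T : {linear X -> Y}),
     bounded_near T (nbhs (0 : X)) ->
     forall n : nat, (1 <= n)%N ->
       (bernstein_number (fun r : R => r) T n <=
        (2 * Num.sqrt 2)%:E * entropy_number (fun r : R => r) T n)%E)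
  /\
  (* complex Banach spaces *)
  (forall (X Y : completeNormedModType R[i]) (T : {linear X -> Y}),
     bounded_near T (nbhs (0 : X)) ->
     forall n : nat, (1 <= n)%N ->
       (bernstein_number (@complex.Re R) T n <=
        (2 * Num.sqrt 2)%:E * entropy_number (@complex.Re R) T n)%E).
Proof.
split=> X Y T _ n n0.
  apply: (@bernstein_le_entropy R R (fun r => r) idfun) => // L [_ [e [Le efree _]]].
  by exists n, e.
apply: (@bernstein_le_entropy R R[i] (@complex.Re R) (real_complex R)) => //.
- by move=> x y; rewrite lecR.
- by move=> z z0; apply: RRe_real; exact: ger0_real.
move=> L [Lsub [e [Le efree _]]].
(* A complex basis e yields the real-free family e, i e. *)
exists (n + n)%N, (fun i => match fintype.split i with
  inl j => e j | inr j => ('i%C : R[i]) *: e j end).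
split=> [|i|a]; first exact: leq_addr.
  case: (fintype.split i) => j //.
  have [L0 LD] := Lsub.
  have Lej : e j \in L by rewrite inE.
  by have := LD 'i%C (e j) 0 Lej L0; rewrite addr0 inE.
have splitl j : fintype.split (lshift n j) = inl j := unsplitK (inl j).
have splitr j : fintype.split (rshift n j) = inr j := unsplitK (inr j).
rewrite big_split_ord /=.
under eq_bigr do rewrite splitl.
under [X in _ + X]eq_bigr do rewrite splitr scalerA.
rewrite -big_split /=.
under eq_bigr do rewrite -scalerDl.
move=> /efree a0 i; rewrite -(splitK i).
case: (fintype.split i) => j /=; have := a0 j.
  by move=> /(congr1 (@complex.Re R)); simpc.
by move=> /(congr1 (@complex.Im R)); simpc.
Qed.
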